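(* Let $r\ge 1$ be an integer. Then there exists a constant $C_r$, depending only on $r$, such that $$\mathsf s_{\{\pm 1\}}(G)\le \exp(G)+\log_2|G|+C_r\log_2\log_2|G|$$ for every finite abelian group $G$ of rank $r$ and even exponent.
   Context: A sequence over $G$ is a finite (unordered) list of elements of $G$, repetitions allowed; a subsequence is a sublist and its length is its number of terms. A sequence $g_1,\ldots,g_n$ is a $\{\pm1\}$-weighted zero-sum sequence if there exist $\varepsilon_1,\ldots,\varepsilon_n\in\{1,-1\}$ with $\sum_{i=1}^n\varepsilon_ig_i=0$. $\mathsf s_{\{\pm1\}}(G)$ is the least integer $m$ such that every sequence over $G$ of length at least $m$ has a $\{\pm1\}$-weighted zero-sum subsequence of length $\exp(G)$. The rank of $G$ is the minimal number of cyclic summands in a decomposition of $G$ as a direct sum of cyclic groups. *)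

(* Defs.v *)
From HB Require Import structures.
From mathcomp Require Import all_boot all_order all_algebra.
From mathcomp Require Import all_fingroup all_solvable.
From mathcomp Require Import boolp reals exp.

Set Implicit Arguments.
Unset Strict Implicit.
Unset Printing Implicit Defensive.

Import Order.TTheory GRing.Theory Num.Theory.
Local Open Scope ring_scope.

(* Finite abelian groups are written additively (finZmodType). A finZmodType
   is canonically a finGroupType, so that exponent, <[x]> and \big[dprod/1]
   from the finite group library apply to it. *)

Definition log2 (R : realType) (x : R) : R := ln x / ln 2.

Section AbelianGroup.
Variable G : finZmodType.

Definition expG : nat := exponent [set: G].

(* G is the internal direct sum of k cyclic subgroups. *)
Definition cyclic_decomposition (k : nat) : Prop :=
  exists2 b : seq G,
    size b = k & \big[dprod/1%g]_(x <- b) <[x]>%g = [set: G] :> {set G}.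

Lemma cyclic_decomposition_ex : exists k, `[< cyclic_decomposition k >].
Proof.
have [b defG _] := abelian_structure (FinRing.zmod_abelian [set: G]).
by exists (size b); apply/asboolP; exists b.
Qed.

Definition rank_of : nat := ex_minn cyclic_decomposition_ex.

(* A finite unordered sequence is represented by a list; the notions below do
   not depend on the order of its terms. *)
Definition pm_zero_sum (t : seq G) : Prop :=
  exists2 e : nat -> int,
    (forall i, e i = 1 \/ e i = -1) & \sum_(i < size t) t`_i *~ e i = 0.

Definition has_pm_zero_sum_subseq (s : seq G) : Prop :=
  exists t : seq G, [/\ subseq t s, size t = expG & pm_zero_sum t].

Definition s_pm_bound (m : nat) : Prop :=
  forall s : seq G, (m <= size s)%N -> has_pm_zero_sum_subseq s.

Lemma s_pm_bound_ex : exists m, `[< s_pm_bound m >].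
Proof.
exists (#|G| * expG).+1; apply/asboolP => s szs.
have [x lex] : exists x : G, (expG <= count_mem x s)%N.
  apply/existsP; apply: contraLR szs; rewrite negb_exists => /forallP cnt.
  rewrite -leqNgt -sum1_size.
  rewrite (partition_big id xpredT) //= -sum_nat_const.
  apply: leq_sum => x _; rewrite sum1_count.
  by apply: ltnW; rewrite ltnNge; apply: cnt.
exists (nseq expG x); split; last 2 first.
- by rewrite size_nseq.
- exists (fun=> 1); first by left.
  rewrite (eq_bigr (fun=> x)); last first.
    by move=> i _; rewrite mulr1z nth_nseq -{2}(size_nseq expG x) ltn_ord.
  rewrite sumr_const card_ord size_nseq -FinRing.zmodXgE.
  by rewrite (expg_exponent (in_setT x)).
have -> : nseq expG x = take expG (filter (pred1 x) s).
  have /all_pred1P -> : all (pred1 x) (filter (pred1 x) s) by exact: filter_all.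
  by rewrite size_filter take_nseq.
exact: subseq_trans (take_subseq _ _) (filter_subseq _ _).
Qed.

(* The constant s_{+1,-1}(G). *)
Definition s_pm : nat := ex_minn s_pm_bound_ex.

End AbelianGroup.

(* Main.v *)
(* Write n = exp(G). A set of indices of the sequence is "pm" when its terms
   have a signed sum equal to 0. Two index sets with equal sums have a pm
   symmetric difference, so pigeonholing on (sum, parity) extracts disjoint pm
   sets of even size until about log_2 |G| indices are left; if the sequence has
   n + log_2 |G| + O_r(1) terms, the total size exceeds n by a small even
   surplus, which remains to be deleted exactly.

   For that purpose a reserve of pm sets of bounded size is set aside first.
   Among the (2r+2)-subsets of a set of about n indices, some sum occurs so often
   that, by a rank argument on intersection sizes, the symmetric differences in
   its class cannot all have their half-size divisible by a given q > 1. Hence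
   the half-sizes occurring abundantly have gcd 1, and every large even surplus
   is a sum of sizes from the reserve. Small n is absorbed by the constant, since
   log_2 log_2 |G| >= 1 when |G| >= 4; |G| = 2 is done by plain pigeonhole. *)

Require Import Defs.
From mathcomp Require Import all_boot all_order all_algebra.
From mathcomp Require Import all_fingroup all_solvable.
From mathcomp Require Import boolp reals exp.
From mathcomp Require Import zify ring.

Import Order.TTheory GRing.Theory Num.Theory.
Local Open Scope ring_scope.

(** * Pigeonhole, growth estimates and a bound on set families *)

Section Counting.
Local Open Scope nat_scope.

Lemma pigeonhole_fiber (aT rT : finType) (f : aT -> rT) (A : {set aT}) (s : nat) :
  #|rT| * s < #|A| -> exists y, s < #|[set x in A | f x == y]|.
Proof.
move=> lt_s; apply/existsP; apply: contraLR lt_s.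
rewrite negb_exists => /forallP le_s; rewrite -leqNgt -sum1_card.
rewrite (partition_big f xpredT) //= -sum_nat_const; apply: leq_sum => y _.
rewrite sum1dep_card leqNgt; exact: le_s.
Qed.

Lemma linear_lt_exp2 (c d : nat) :
  exists w0, forall w, w0 <= w -> c * w + d < 2 ^ w.
Proof.
exists (2 * (2 * c + d + 1)) => w le_w.
have w_half : w = w./2 + w./2 + odd w by rewrite -{1}(odd_double_half w); lia.
have lt1 : w./2 < 2 ^ w./2 by exact: ltn_expl.
have le2 : 2 ^ (w./2 + w./2) <= 2 ^ w by apply: leq_pexp2l => //; lia.
rewrite expnD in le2; set v := w./2 in w_half lt1 le2 *.
have : (v + 1) * (v + 1) <= 2 ^ v * 2 ^ v by apply: leq_mul; lia.
have : (2 * c + d + 1) * (v + 1) <= (v + 1) * (v + 1).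
  by rewrite leq_mul2r; apply/orP; right; lia.
case: (odd w) w_half => /=; nia.
Qed.

(** For [r > 0] the hypothesis makes [a] exponential in [t / r], so [a] outgrows any linear function
    of [t]. With [t] about log_2 |G|, this pays for the reserve. *)
Lemma log_negligible (r c d : nat) :
  exists a0, forall a t, a0 <= a -> 2 ^ t <= (2 * a) ^ r -> c * t + d <= a.
Proof.
have [w0 hw] := linear_lt_exp2 (2 * c * r) (2 * c * r + 2 * d).
case: r hw => [|r] hw.
  exists d => a t le_da; rewrite expn0 => t_le.
  suff -> : t = 0 by lia.
  by case: t t_le => // t; rewrite expnS; have := expn_gt0 2 t; lia.
(* This value settles [t <= r.+1 * w0]; for larger [t], a failure would give
   [2 * a < 2 ^ (t %/ r.+1)], against [le_t]. *)
exists (c * (r.+1 * w0) + d) => a t le_a le_t; rewrite leqNgt; apply/negP => lt_a.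
have le_wt : w0 <= t %/ r.+1.
  rewrite leq_divRL //; apply/ltnW; rewrite ltnNge; apply/negP => t_le.
  have : c * t <= c * (r.+1 * w0) by rewrite leq_mul2l; apply/orP; right; lia.
  lia.
have lt_t : t < (t %/ r.+1).+1 * r.+1 by exact: ltn_ceil.
have {}hw := hw _ le_wt.
have lt2 : 2 * a < 2 ^ (t %/ r.+1) by nia.
move: le_t; rewrite leqNgt => /negP; apply.
apply: (@leq_trans ((2 ^ (t %/ r.+1)) ^ r.+1)); first by rewrite ltn_exp2r.
by rewrite -expnM leq_pexp2l // leq_divM.
Qed.

Lemma exp_le_bin (M k a : nat) : a + k <= M -> a ^ k <= 'C(M, k) * k`!.
Proof.
rewrite bin_ffact; elim: k M => [|k IHk] M le_M; first by rewrite ffactn0.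
case: M le_M => [|M] le_M; first by lia.
rewrite ffactSS expnS; apply: leq_mul; [lia | apply: IHk; lia].
Qed.

(* The functions [fun B => \prod_i (q (i + 1) - (k - #|A :&: B|))], for [A] in
   [F], vanish on [F :\ A] but not at [A]; their matrix is diagonal of full
   rank, yet it is a Hadamard product of [k./2] matrices of rank at most
   [#|I| + 1]. *)
Lemma card_divisible_code (I : finType) (F : {set {set I}}) (q k : nat) :
  1 < q -> {in F, forall A : {set I}, #|A| = k} ->
  {in F &, forall A B, A != B -> q %| k - #|A :&: B|} ->
  #|F| <= #|I|.+1 ^ k./2.
Proof.
move=> q_gt1 cardF divF; set s := k./2.
pose b (i : nat) : rat := ((q * i.+1)%:R - k%:R)%R.
(* The coordinate [None] carries the constant term, so that [#|A :&: B| + b i] is an inner product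
   in dimension [#|I|.+1]. *)
pose u (A : {set I}) (x : option I) : rat :=
  if x is Some y then (y \in A)%:R%R else 1%R.
pose v (i : nat) (A : {set I}) (x : option I) : rat :=
  if x is Some y then (y \in A)%:R%R else b i.
have uv A B i : (\sum_x u A x * v i B x = #|A :&: B|%:R + b i)%R.
  rewrite (bigD1 None) //= mul1r addrC; congr (_ + _)%R.
  rewrite (reindex_omap Some id); last by case.
  rewrite /= -sum1_card natr_sum big_mkcond [RHS]big_mkcond /=.
  apply: eq_bigr => x _; rewrite eqxx inE.
  by case: (x \in A); case: (x \in B); rewrite ?mulr0 ?mul0r ?mulr1.
pose D := {ffun 'I_s -> option I}.
pose eF (i : 'I_#|F|) : {set I} := enum_val i.
pose eD (i : 'I_#|D|) : D := enum_val i.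
pose U : 'M[rat]_(#|F|, #|D|) := (\matrix_(i, j) \prod_(t < s) u (eF i) (eD j t))%R.
pose V : 'M[rat]_(#|D|, #|F|) := (\matrix_(j, i) \prod_(t < s) v t (eF i) (eD j t))%R.
have UV i j : ((U *m V) i j = \prod_(t < s) (#|eF i :&: eF j|%:R + b t))%R.
  under [RHS]eq_bigr do rewrite -uv.
  rewrite bigA_distr_bigA /= mxE.
  rewrite (reindex_onto (enum_rank : D -> _) enum_val) /=; last first.
    by move=> x _; exact: enum_valK.
  rewrite (eq_bigl xpredT) => [|x]; last by rewrite enum_rankK eqxx.
  by apply: eq_bigr => f _; rewrite !mxE -big_split /= /eD enum_rankK.
have UV_diag : (U *m V = diag_mx (\row_i (U *m V) i i))%R.
  apply/matrixP => i j; rewrite [RHS]mxE [X in (X *+ _)%R]mxE.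
  have [->|ne_ij] := eqVneq i j; first by rewrite mulr1n.
  have [Fi Fj] : eF i \in F /\ eF j \in F by split; exact: enum_valP.
  have ne_e : eF i != eF j by apply: contra ne_ij => /eqP/enum_val_inj ->.
  have /dvdnP[d def_d] := divF _ _ Fi Fj ne_e.
  have lt_k : #|eF i :&: eF j| < k.
    rewrite ltn_neqAle -{2}(cardF _ Fi) subset_leq_card ?subsetIl // andbT.
    apply: contra ne_e => /eqP cardI.
    have sub (A : {set I}) : A \in F -> eF i :&: eF j \subset A -> eF i :&: eF j = A.
      by move=> FA sA; apply/eqP; rewrite eqEcard sA cardI (cardF _ FA) leqnn.
    by rewrite -(sub _ Fi (subsetIl _ _)) {1}(sub _ Fj (subsetIr _ _)).
  have d_gt0 : 0 < d by case: d def_d => //; lia.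
  (* As [q >= 2], [d * q <= k] gives [d <= k./2]: the factor of index [d.-1] is present, and it
     vanishes. *)
  have lt_ds : d.-1 < s.
    by rewrite /s; have := odd_double_half k; case: (odd k) => /=; nia.
  rewrite UV mulr0n (bigD1 (Ordinal lt_ds)) //=.
  have -> : (#|eF i :&: eF j|%:R + b d.-1 = 0)%R; last by rewrite mul0r.
  rewrite /b prednK // mulnC -def_d natrB ?(ltnW lt_k) //.
  by rewrite addrC -addrA [(- _ + _)%R]addrC addrA subrK subrr.
have nz_diag i : ((U *m V) i i != 0)%R.
  rewrite UV; apply/prodf_neq0 => t _.
  rewrite setIid (cardF _ (enum_valP i)) /b addrC subrK pnatr_eq0 muln_eq0.
  by rewrite orbF -lt0n ltnW.
have : row_free (U *m V).
  rewrite row_free_unit UV_diag unitmxE det_diag unitfE.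
  by apply/prodf_neq0 => i _; rewrite mxE.
rewrite /row_free => /eqP rkUV.
have := mulmx_max_rank U V; rewrite rkUV.
by rewrite card_ffun card_option card_ord.
Qed.

Lemma pigeonhole_size (aT rT : finType) (f : aT -> rT) (n : nat) :
  #|rT| * n < #|aT| -> exists2 A : {set aT}, #|A| = n.+1 &
    exists y, {in A, forall x, f x = y}.
Proof.
rewrite -[#|aT|]cardsT => lt_card; have [y lt_n] := pigeonhole_fiber _ _ f _ _ lt_card.
have [A sA cardA] : exists2 A : {set aT},
    A \subset [set x in [set: aT] | f x == y] & #|A| = n.+1.
  have : 0 < #|[set A : {set aT} | A \subset [set x in [set: aT] | f x == y]
                  & #|A| == n.+1]| by rewrite cards_draws bin_gt0.
  by case/card_gt0P => A; rewrite inE => /andP[sA /eqP cA]; exists A.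
exists A => //; exists y => x Ax.
by have := subsetP sA _ Ax; rewrite !inE => /eqP.
Qed.

End Counting.

(** * Index sets with a vanishing signed sum *)

Section PlusMinusSets.
Local Open Scope nat_scope.
Variables (G : finZmodType) (I : finType) (g : I -> G).

Definition pm_set (A : {set I}) : Prop :=
  exists e : I -> bool, (\sum_(i in A) (if e i then g i else - g i) = 0)%R.

Lemma pm_set0 : pm_set set0.
Proof. by exists xpredT; rewrite big_set0. Qed.

Lemma pm_setU (A B : {set I}) :
  [disjoint A & B] -> pm_set A -> pm_set B -> pm_set (A :|: B).
Proof.
move=> dAB [e eA] [f fB]; exists (fun i => if i \in A then e i else f i).
rewrite (big_setID A) /= (setIidPr (subsetUl A B)) setDUl setDv set0U.
rewrite (setDidPl _); last by rewrite disjoint_sym.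
rewrite -[RHS]addr0 -[X in (_ = X + _)%R]eA -[X in (_ = _ + X)%R]fB.
congr (_ + _)%R; apply: eq_bigr => i; first by move=> ->.
by move=> Bi; rewrite (disjointFl dAB Bi).
Qed.

(** Signs are plus on [A :\: B] and minus on [B :\: A]; the terms over [A :&: B] cancel from the two
    equal sums. *)
Lemma pm_set_symdiff (A B : {set I}) :
  (\sum_(i in A) g i = \sum_(i in B) g i)%R ->
  pm_set ((A :\: B) :|: (B :\: A)).
Proof.
move=> eqAB; exists (fun i => i \in A).
rewrite (big_setID A) /= setIUl setDUl.
have -> : (A :\: B) :&: A = A :\: B by apply/setIidPl; exact: subsetDl.
have -> : (B :\: A) :&: A = set0 by rewrite setIC setIDA setIC -setIDA setDv setI0.
have -> : (A :\: B) :\: A = set0 by apply/eqP; rewrite setD_eq0 subsetDl.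
have -> : (B :\: A) :\: A = B :\: A by rewrite setDDl setUid.
rewrite setU0 set0U.
rewrite (eq_bigr g) => [|i]; last by rewrite inE => /andP[_ ->].
rewrite [X in (_ + X)%R](eq_bigr (fun i => - g i)%R) => [|i]; last first.
  by rewrite inE => /andP[/negbTE -> _].
rewrite sumrN; apply/eqP; rewrite subr_eq0; apply/eqP.
move: eqAB; rewrite (big_setID B) [RHS](big_setID A) /= [B :&: A]setIC.
exact: addrI.
Qed.

Lemma card_symdiff (A B : {set I}) :
  #|(A :\: B) :|: (B :\: A)| + 2 * #|A :&: B| = #|A| + #|B|.
Proof.
rewrite cardsU.
have -> : (A :\: B) :&: (B :\: A) = set0.
  by apply/setP => x; rewrite !inE; case: (x \in A); case: (x \in B).
rewrite cards0; have := cardsID B A; have := cardsID A B; rewrite [B :&: A]setIC.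
lia.
Qed.

Lemma symdiff_neq0 (A B : {set I}) : A != B -> (A :\: B) :|: (B :\: A) != set0.
Proof.
by apply: contra; rewrite setU_eq0 !setD_eq0 => ?; rewrite eqEsubset.
Qed.

Lemma symdiff_sub (A B W : {set I}) :
  A \subset W -> B \subset W -> (A :\: B) :|: (B :\: A) \subset W.
Proof.
by move=> sA sB; rewrite subUset !(subset_trans (subsetDl _ _)).
Qed.

(** There are fewer pairs (sum, parity of size) than subsets of [W]; equal parities make the
    symmetric difference even. *)
Lemma even_pm_set (W : {set I}) : 2 * #|G| < 2 ^ #|W| ->
  exists T : {set I}, [/\ T \subset W, T != set0, pm_set T & ~~ odd #|T|].
Proof.
pose f (A : {set I}) := ((\sum_(i in A) g i)%R, odd #|A|).
rewrite -card_powerset mulnC -card_bool -card_prod -[X in X < _]muln1.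
move=> /(pigeonhole_fiber _ _ f)[y /card_gt1P[A [B [+ + neAB]]]].
rewrite !inE => /andP[sA /eqP fA] /andP[sB /eqP fB].
have [sumAB oddAB] : f A = f B by rewrite fA.
exists ((A :\: B) :|: (B :\: A)); split.
- exact: symdiff_sub.
- exact: symdiff_neq0.
- exact: pm_set_symdiff.
- have /(congr1 odd) := card_symdiff A B.
  by rewrite mul2n !oddD odd_double addbF oddAB addbb => ->.
Qed.

(** Greedy: [even_pm_set] applies as long as more than [t] indices remain. *)
Lemma even_pm_exhaust (t : nat) (W : {set I}) : 2 * #|G| < 2 ^ t.+1 ->
  exists U : {set I}, [/\ U \subset W, pm_set U, ~~ odd #|U| & #|W :\: U| <= t].
Proof.
move=> G_lt; have [n] := ubnP #|W|; elim: n W => // n IHn W lt_n.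
have [le_t|lt_t] := leqP #|W| t.
  by exists set0; rewrite sub0set setD0 cards0; split=> //; exact: pm_set0.
have [|T [sT nzT pmT evT]] := even_pm_set W.
  by apply: leq_trans G_lt _; rewrite leq_pexp2l.
have [|U [sU pmU evU le_t]] := IHn (W :\: T).
  have := cardsD W T; rewrite (setIidPr sT).
  by rewrite -card_gt0 in nzT; have := subset_leq_card sT; lia.
have dTU : [disjoint T & U].
  by rewrite disjoint_sym; move: sU; rewrite subsetD => /andP[].
exists (T :|: U); split.
- by rewrite subUset sT (subset_trans sU) ?subsetDl.
- exact: pm_setU.
- have := leq_card_setU T U; rewrite dTU => -[_ /eqP ->].
  by rewrite oddD (negbTE evT).
- by rewrite -setDDl.
Qed.

(** Some sum is shared by more [k]-subsets than [card_divisible_code] permits, so [q] fails to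
    divide some [k - #|A :&: B|]. That number is half the size of the symmetric difference, and
    serves as [l]. *)
Lemma pm_set_not_dvd (W : {set I}) (k q : nat) : 1 < q ->
  #|G| * #|I|.+1 ^ k./2 < 'C(#|W|, k) ->
  exists (T : {set I}) (l : nat),
    [/\ T \subset W, pm_set T, #|T| = 2 * l & 0 < l <= k /\ ~~ (q %| l)].
Proof.
move=> q_gt1; rewrite -cards_draws.
pose f (A : {set I}) := (\sum_(i in A) g i)%R.
move=> /(pigeonhole_fiber _ _ f)[y]; set F := [set A in _ | _] => F_gt.
have inF A : A \in F -> [/\ A \subset W, #|A| = k & f A = y].
  by rewrite !inE -andbA => /and3P[? /eqP ? /eqP].
have [A [B [FA FB neAB ndiv]]] : exists A B : {set I},
    [/\ A \in F, B \in F, A != B & ~~ (q %| k - #|A :&: B|)].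
  apply: contrapT => none; suff : #|F| <= #|I|.+1 ^ k./2 by rewrite leqNgt F_gt.
  apply: (card_divisible_code _ _ q) => // [A /inF[] //|A B FA FB neAB].
  by apply: contrapT => /negP ndiv; apply: none; exists A, B.
have [[sA cA fA] [sB cB fB]] := (inF _ FA, inF _ FB).
exists ((A :\: B) :|: (B :\: A)), (k - #|A :&: B|).
have := card_symdiff A B; have := subset_leq_card (subsetIl A B).
have := symdiff_neq0 _ _ neAB; rewrite -card_gt0.
split; [exact: symdiff_sub | | lia | split=> //; lia].
by apply: pm_set_symdiff; rewrite -/(f A) -/(f B) fA fB.
Qed.

(** Disjoint pm sets of size [d] are collected greedily: either [N] are found, any [c] of which can
    be kept, or the search stops early with none left. *)
Lemma pm_copies (d N : nat) (W : {set I}) :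
  (exists R : {set I}, [/\ R \subset W, #|R| = N * d &
     forall c, c <= N -> exists R' : {set I},
       [/\ R' \subset R, pm_set R' & #|R'| = c * d]]) \/
  (exists W' : {set I}, [/\ W' \subset W, #|W :\: W'| <= N * d &
     forall T : {set I}, T \subset W' -> pm_set T -> #|T| != d]).
Proof.
elim: N => [|N [[R [sR cR subR]]|[W' [sW' cW' noT]]]].
- left; exists set0; split; rewrite ?sub0set ?cards0 //.
  move=> c; rewrite leqn0 => /eqP ->; exists set0; rewrite cards0.
  by split=> //; exact: pm_set0.
- have [[T [sT pmT cT]]|noT] := pselect (exists T : {set I},
    [/\ T \subset W :\: R, pm_set T & #|T| = d]); last first.
    right; exists (W :\: R); rewrite subsetDl setDDr setDv set0U.
    rewrite (setIidPr sR) cR leq_mul2r leqnSn orbT; split=> // T sT pmT.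
    by apply/eqP => cT; apply: noT; exists T.
  left; exists (R :|: T).
  have dTR : [disjoint T & R] by move: sT; rewrite subsetD => /andP[].
  have cardU (R' : {set I}) : R' \subset R -> #|R' :|: T| = #|R'| + #|T|.
    move=> sR'; have := leq_card_setU R' T; rewrite disjoint_sym.
    by rewrite (disjointWr sR' dTR) => -[_ /eqP].
  split.
  + by rewrite subUset sR (subset_trans sT) ?subsetDl.
  + by rewrite cardU // cR cT mulSn addnC.
  + move=> [|c] le_c.
      by exists set0; rewrite sub0set cards0; split=> //; exact: pm_set0.
    have [R' [sR' pmR' cR']] := subR c le_c.
    exists (R' :|: T); split; first by rewrite setSU.
      by apply: pm_setU => //; rewrite disjoint_sym (disjointWr sR').
    by rewrite cardU // cR' cT mulSn addnC.
- right; exists W'; split=> //.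
  by apply: leq_trans cW' _; rewrite leq_mul2r leqnSn orbT.
Qed.

(** [pm_copies] is applied to the half-sizes [i.+1] in turn. [L] records the abundant ones, with [N]
    copies each in the reserve [R]; the other half-sizes listed in [s] no longer occur in [W']. *)
Lemma pm_reserve_seq (k N : nat) (W : {set I}) (s : seq 'I_k) : uniq s ->
  exists (L : {set 'I_k}) (R W' : {set I}),
  [/\ R \subset W, W' \subset W :\: R & #|W :\: W'| <= size s * (N * (2 * k))] /\
  [/\ #|R| = \sum_(i in L) N * (2 * i.+1),
   forall c : 'I_k -> nat, (forall i, c i <= N) -> exists R' : {set I},
     [/\ R' \subset R, pm_set R' & #|R'| = \sum_(i in L) c i * (2 * i.+1)],
   {subset L <= s} &
   forall T : {set I}, T \subset W' -> pm_set T ->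
     forall i : 'I_k, i \in s -> #|T| = 2 * i.+1 -> i \in L].
Proof.
elim: s => [_|i s IHs /= /andP[nsi us]].
  exists set0, set0, W; rewrite !sub0set setD0 setDv subxx cards0 big_set0.
  do 2?split=> //; last by move=> i; rewrite inE.
  by move=> c _; exists set0; rewrite cards0 big_set0; split=> //; exact: pm_set0.
have [L [R [W' [[sR sW' cW'] [cR subR sL noT]]]]] := IHs us.
have nLi : i \notin L by apply: contra nsi; exact: sL.
have dR : [disjoint W' & R] by move: sW'; rewrite subsetD => /andP[].
have sWW' : W' \subset W by apply: subset_trans sW' (subsetDl _ _).
have le_i : N * (2 * i.+1) <= N * (2 * k).
  by rewrite leq_mul2l leq_mul2l ltn_ord !orbT.
have cardWD (Y : {set I}) : Y \subset W' -> #|W' :\: Y| <= N * (2 * i.+1) ->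
    #|W :\: Y| <= (size s).+1 * (N * (2 * k)).
  move=> sY leY; rewrite mulSn addnC.
  apply: leq_trans (leq_add cW' (leq_trans leY le_i)).
  apply: leq_trans (leq_card_setU _ _); apply: subset_leq_card.
  apply/subsetP => x; rewrite !inE; case: (x \in W'); last by rewrite /= => /andP[_ ->].
  by rewrite andbT => /andP[-> _].
have [[Q [sQ cQ subQ]]|[V [sV cV noV]]] := pm_copies (2 * i.+1) N W'; last first.
  exists L, R, V; split; split=> //.
  - exact: subset_trans sV sW'.
  - exact: cardWD.
  - by move=> j /sL js; rewrite inE js orbT.
  - move=> T sT pmT j; rewrite inE => /predU1P[-> cT|sj cT].
      by have := noV T sT pmT; rewrite cT eqxx.
    by apply: (noT T _ pmT j) => //; exact: subset_trans sT sV.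
exists (i |: L), (R :|: Q), (W' :\: Q).
have dRQ (R' Q' : {set I}) : R' \subset R -> Q' \subset Q -> [disjoint R' & Q'].
  move=> sR' sQ'; apply: disjointWl sR' _; apply: disjointWr sQ' _.
  by rewrite disjoint_sym; apply: disjointWl sQ dR.
have cardU (R' Q' : {set I}) : R' \subset R -> Q' \subset Q ->
    #|R' :|: Q'| = #|R'| + #|Q'|.
  move=> sR' sQ'; have := leq_card_setU R' Q'.
  by rewrite dRQ // => -[_ /eqP].
split; split.
- by rewrite subUset sR (subset_trans sQ sWW').
- by rewrite -setDDl setSD.
- by apply: cardWD; rewrite ?subsetDl // setDDr setDv set0U (setIidPr sQ) cQ.
- by rewrite cardU // cR cQ big_setU1 //= addnC.
- move=> c le_c; have [R' [sR' pmR' cR']] := subR c le_c.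
  have [Q' [sQ' pmQ' cQ']] := subQ (c i) (le_c i).
  exists (R' :|: Q'); split; first exact: setUSS.
    by apply: pm_setU => //; exact: dRQ.
  by rewrite cardU // cR' cQ' big_setU1 //= addnC.
- move=> j; rewrite in_setU1 inE => /predU1P[->|/sL ->]; first by rewrite eqxx.
  by rewrite orbT.
- move=> T sT pmT j; rewrite in_setU1 inE; case: eqVneq => //= _ sj cT.
  by apply: (noT T _ pmT j sj cT); apply: subset_trans sT (subsetDl _ _).
Qed.

End PlusMinusSets.

(** * Numerical semigroups and the case of large exponent *)

Section LargeExponent.
Local Open Scope nat_scope.

Lemma numerical_semigroup (k : nat) (L : {set 'I_k}) :
  (forall q, 1 < q -> exists2 i, i \in L & ~~ (q %| i.+1)) ->
  exists e0, forall e, e0 <= e -> exists c : 'I_k -> nat,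
    e = \sum_(i in L) c i * i.+1.
Proof.
move=> gcdL.
pose rep (e : nat) := exists c : 'I_k -> nat, e = \sum_(i in L) c i * i.+1.
have rep0 : rep 0 by exists (fun=> 0); rewrite big1.
have repD x y : rep x -> rep y -> rep (x + y).
  move=> [c ->] [d ->]; exists (fun i => c i + d i).
  by rewrite -big_split /=; apply: eq_bigr => i _; rewrite mulnDl.
have repM m x : rep x -> rep (m * x).
  by move=> rx; elim: m => [//|m IHm]; rewrite mulSn; exact: repD.
have rep1 i : i \in L -> rep i.+1.
  move=> Li; exists (fun j => (j == i : nat)); rewrite (bigD1 i) //= eqxx mul1n.
  by rewrite big1 ?addn0 // => j /andP[_ /negbTE ->].
pose diff (d : nat) := 0 < d /\ exists2 x, rep x & rep (x + d).
have exdiff : exists d, `[< diff d >].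
  have [i Li _] := gcdL 2 isT; exists i.+1; apply/asboolP; split=> //.
  by exists 0 => //; exact: rep1.
case: (ex_minnP exdiff) => d /asboolP[d_gt0 [x rx rxd]] min_d.
(* The least positive difference of two representable numbers divides every
   generator, so it is [1]. *)
have d1 : d = 1.
  apply/eqP; rewrite eqn_leq d_gt0 andbT leqNgt; apply/negP => d_gt1.
  have [i Li ndvd] := gcdL d d_gt1.
  have : d <= i.+1 %% d.
    apply: min_d; apply/asboolP; split; first by rewrite lt0n.
    exists ((i.+1 %/ d) * (x + d)); first exact: repM.
    have -> : (i.+1 %/ d) * (x + d) + i.+1 %% d = (i.+1 %/ d) * x + i.+1.
      by rewrite mulnDr -addnA -divn_eq.
    by apply: repD; [exact: repM | exact: rep1].
  by rewrite leqNgt ltn_pmod.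
(* With [x] and [x + 1] representable, [e] is a sum of [e %/ x] of them, [e %% x] being [x + 1];
   [x * x <= e] ensures [e %% x <= e %/ x]. *)
rewrite d1 in rxd; exists (x * x) => e le_e.
have [x0|x_gt0] := posnP x.
  by rewrite -[e]muln1; apply: repM; rewrite x0 in rxd.
have le_x : e %% x <= e %/ x.
  by apply: leq_trans (ltnW (ltn_pmod e x_gt0)) _; rewrite leq_divRL.
have -> : e = (e %/ x - e %% x) * x + (e %% x) * (x + 1).
  by rewrite mulnDr muln1 addnA -mulnDl subnK // -divn_eq.
by apply: repD; exact: repM.
Qed.

(** [L] will depend on the group, but the threshold only on [r]; there are finitely many [L], so a
    maximum is taken. *)
Lemma uniform_numerical_semigroup (k : nat) :
  exists e0, forall L : {set 'I_k},
    (forall q, 1 < q -> exists2 i, i \in L & ~~ (q %| i.+1)) ->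
    forall e, e0 <= e -> exists c : 'I_k -> nat, e = \sum_(i in L) c i * i.+1.
Proof.
pose P (L : {set 'I_k}) e0 :=
  (forall q, 1 < q -> exists2 i, i \in L & ~~ (q %| i.+1)) ->
  forall e, e0 <= e -> exists c : 'I_k -> nat, e = \sum_(i in L) c i * i.+1.
have /choice[f fP] : forall L, exists e0, P L e0.
  move=> L; have [gcdL|] := pselect (forall q, 1 < q ->
    exists2 i, i \in L & ~~ (q %| i.+1)); last by exists 0.
  by have [e0 e0P] := numerical_semigroup _ _ gcdL; exists e0 => _.
exists (\max_L f L) => L gcdL e le_e; apply: (fP L) => //.
by apply: leq_trans le_e; exact: leq_bigmax.
Qed.

Lemma pm_set_large (r : nat) : exists D a0, forall (G : finZmodType)
    (I : finType) (g : I -> G) (a : nat),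
  #|G| <= (2 * a) ^ r -> a0 <= a ->
  #|I| = 2 * a + trunc_log 2 #|G| + 1 + D ->
  exists2 A : {set I}, #|A| = 2 * a & pm_set G I g A.
Proof.
(* [#|G|] contributes [r] factors [a] and the code bound [k./2 = r.+1] more: one fewer than the
   [a ^ k] supplied by ['C(#|W|, k)]. *)
pose k := (r.+1).*2.
have [e0 e0P] := uniform_numerical_semigroup k.
(* Building the reserve costs at most [k * (N * (2 * k)) = K * N] indices. *)
pose K := 2 * k * k.
pose d := K * (1 + 2 * e0) + k + 2 + 2 * e0.
have [a1 a1P] := log_negligible r (K + 1) d.
exists (2 * e0), (a1 + (k`! * (2 ^ r * 6 ^ r.+1)).+1) => G I g a cardG le_a.
set t := trunc_log 2 #|G| => cardI.
have G_gt0 : 0 < #|G| by apply/card_gt0P; exists 0%R.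
have le_t : 2 ^ t <= #|G| by exact: trunc_logP.
have lt_t : #|G| < 2 ^ t.+1 by exact: trunc_log_ltn.
(* This is [#|I| - 2 * a], hence a bound for the surplus [e] and for each multiplicity [c i]. *)
pose N := t + 1 + 2 * e0.
have le_ta : (K + 1) * t + d <= a.
  by apply: a1P; [lia | exact: leq_trans cardG].
have [L [R [W [[_ sW cW] [cR subR _ noW]]]]] :=
  pm_reserve_seq G I g k N [set: I] (enum 'I_k) (enum_uniq _).
rewrite size_enum_ord in cW.
have W_ge : a + k <= #|W|.
  have := cardsC W; rewrite -setTD => cC.
  have eK : k * (N * (2 * k)) = K * t + K * (1 + 2 * e0).
    by rewrite /K /N; ring.
  rewrite eK in cW; move: le_ta; rewrite /d mulnDl mul1n; lia.
(* Enough of [W] survives to contain a pm set of half-size [l <= k] not divisible by [q]; by [noW],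
   [l] is abundant, at index [l.-1]. *)
have gcdL q : 1 < q -> exists2 i, i \in L & ~~ (q %| i.+1).
  move=> q_gt1; have [|T [l [sT pmT cT [/andP[l_gt0 le_l] ndvd]]]] :=
    pm_set_not_dvd G I g W k q q_gt1; last first.
    have lt_l : l.-1 < k by lia.
    exists (Ordinal lt_l); last by rewrite /= prednK.
    by apply: (noW T) => //=; rewrite ?mem_enum // prednK.
  rewrite /k doubleK -/k -(ltn_pmul2r (fact_gt0 k)).
  apply: leq_trans (exp_le_bin _ _ _ W_ge).
  have le_I : #|I|.+1 <= 6 * a.
    by move: le_ta; rewrite cardI /d mulnDl mul1n; lia.
  apply: (@leq_ltn_trans (((2 * a) ^ r * (6 * a) ^ r.+1) * k`!)).
    by rewrite leq_mul2r leq_mul ?orbT // leq_exp2r.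
  have -> : (2 * a) ^ r * (6 * a) ^ r.+1 * k`! =
            (k`! * (2 ^ r * 6 ^ r.+1)) * a ^ (r + r.+1).
    by rewrite !expnMn expnD; ring.
  have -> : a ^ k = a * a ^ (r + r.+1).
    by rewrite -expnS /k -addnn addSn.
  have a_gt0 : 0 < a by lia.
  by rewrite ltn_pmul2r ?expn_gt0 ?a_gt0 //; lia.
have [|U [sU pmU evU cU]] := even_pm_exhaust G I g t.+1 ([set: I] :\: R).
  by rewrite expnS ltn_pmul2l.
have dUR : [disjoint U & R] by move: sU; rewrite subsetD => /andP[].
have cardUR : #|U| + #|R| + #|([set: I] :\: R) :\: U| = #|I|.
  have := cardsD ([set: I] :\: R) U; rewrite (setIidPr sU).
  have := cardsC R; rewrite -setTD; have := subset_leq_card sU; lia.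
have evR : ~~ odd #|R|.
  by rewrite cR; elim/big_rec: _ => // i m _; rewrite oddD oddM oddM /= andbF.
pose e := (#|U| + #|R| - 2 * a)./2.
have def_e : 2 * e = #|U| + #|R| - 2 * a.
  rewrite mul2n halfK oddB; last by lia.
  by rewrite oddD (negbTE evU) (negbTE evR) oddM subn0.
(* At most [t.+1] indices lie outside [U :|: R], so the [2 * e0] extra terms give [e0 <= e]. *)
have [c def_c] := e0P L gcdL e ltac:(lia).
have le_c i : i \in L -> c i <= N.
  move=> Li; have : c i <= e.
    by rewrite def_c (bigD1 i) //= mulnS -addnA leq_addr.
  lia.
(* Leaving out [c i] copies of size [2 * i.+1] for each [i] in [L] lowers the total by exactly
   [2 * e]. *)
have [i|R' [sR' pmR' cR']] := subR (fun i => N - c i); first exact: leq_subr.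
have dUR' : [disjoint U & R'] by exact: disjointWr dUR.
exists (U :|: R'); last exact: pm_setU.
have := leq_card_setU U R'; rewrite dUR' => -[_ /eqP ->].
have : #|R'| + 2 * e = #|R|.
  rewrite cR' cR def_c big_distrr -big_split /=; apply: eq_bigr => i Li.
  by rewrite (mulnCA 2) -mulnDl subnK ?le_c.
lia.
Qed.

End LargeExponent.

(** * From index sets to subsequences, and elementary bounds *)

Section Transfer.
Local Open Scope nat_scope.
Variable G : finZmodType.

Lemma s_pm_le (m : nat) :
  (forall g : 'I_m -> G, exists2 A : {set 'I_m}, #|A| = expG G & pm_set G _ g A) ->
  s_pm G <= m.
Proof.
move=> ex_pm; rewrite /s_pm; case: ex_minnP => k _; apply; apply/asboolP => s le_m.
have [A cA [e eA]] := ex_pm (fun i => s`_i)%R.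
pose r := enum A.
have size_r : size r = expG G by rewrite -cA cardE.
exists [seq s`_(val i) | i <- r]%R; split; last 2 first.
- by rewrite size_map.
(* The head of [drop j r] is the [j]-th index of [A]; this carries the signs over to positions. *)
- pose f j := if drop j r is i :: _ then e i else true.
  exists (fun j => if f j then 1%R else (-1)%R).
    by move=> j; case: (f j); [left | right].
  have /card_gt0P[i0 _] : 0 < #|A| by rewrite cA exponent_gt0.
  rewrite size_map; apply: etrans eA; rewrite -[RHS]big_enum /= -/r.
  rewrite [RHS](big_nth i0) big_mkord.
  apply: eq_bigr => j _.
  rewrite (nth_map i0) // /f (drop_nth i0) //.
  by case: (e _); rewrite ?mulr1z ?mulrN1z.
(* [enum A] is increasing, so the chosen terms form a subsequence of the first [m] terms. *)
- have -> : [seq s`_(val i) | i <- r]%R = [seq s`_j | j <- map val r]%R.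
    by rewrite -map_comp.
  apply: subseq_trans (take_subseq s m); rewrite -(map_nth_iota0 0%R) //.
  apply: map_subseq; rewrite -val_enum_ord; apply: map_subseq.
  by rewrite /r enumT; exact: filter_subseq.
Qed.

Lemma expG_gt0 : 0 < expG G.
Proof. exact: exponent_gt0. Qed.

Lemma expG_dvd_card : expG G %| #|G|.
Proof. by rewrite -cardsT; exact: exponent_dvdn. Qed.

(** [expG G] equal terms, all with sign plus, sum to zero. *)
Lemma s_pm_le_pigeonhole : s_pm G <= (#|G| * (expG G).-1).+1.
Proof.
apply: s_pm_le => g.
have [|A cA [y gA]] := pigeonhole_size _ _ g (expG G).-1; first by rewrite card_ord.
rewrite prednK ?expG_gt0 // in cA.
exists A => //; exists xpredT; rewrite (eq_bigr (fun=> y)) //.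
by rewrite sumr_const cA -FinRing.zmodXgE (expg_exponent (in_setT y)).
Qed.

Lemma card_le_expG_rank : #|G| <= expG G ^ rank_of G.
Proof.
rewrite /rank_of; case: ex_minnP => k /asboolP[b <-] defG _.
rewrite -[#|G|]cardsT -(bigdprod_card defG).
elim: b {defG} => [|x b IHb]; first by rewrite big_nil.
rewrite big_cons expnS; apply: leq_mul => //.
by apply: dvdn_leq (expG_gt0) _; exact: (dvdn_exponent (in_setT x)).
Qed.

End Transfer.

(** * Binary logarithms *)

Section Logarithms.
Variable R : realType.

Lemma log2_pow (t : nat) : log2 ((2 ^ t)%:R : R) = t%:R.
Proof.
have ln2 : ln (2%:R : R) != 0 by rewrite gt_eqF // ln_gt0 // ltr1n.
by rewrite /log2 natrX lnXn ?ltr0n // mulrnAl divff.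
Qed.

Lemma le_log2 (x y : R) : 0 < x -> x <= y -> log2 x <= log2 y.
Proof.
move=> x_gt0 le_xy; rewrite /log2 ler_pM2r; last first.
  by rewrite invr_gt0 ln_gt0 // ltr1n.
by rewrite ler_ln // posrE ?(lt_le_trans x_gt0).
Qed.

End Logarithms.

(** * Choice of the constant and conclusion *)

Theorem theorem1p2 (R : realType) (r : nat) (hr : (1 <= r)%N) :
  exists C : R, forall G : finZmodType,
    rank_of G = r -> ~~ odd (expG G) ->
    (s_pm G)%:R <=
      (expG G)%:R + log2 (#|G|%:R : R) + C * log2 (log2 (#|G|%:R : R)).
Proof.
have [D [a0 large]] := pm_set_large r.
(* [D + 1] serves [a0 <= a]; the last summand dominates the pigeonhole bound when [a < a0]. *)
pose C := (D + 1 + ((2 * a0) ^ r * (2 * a0) + 1))%N.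
exists C%:R => G rkG evG.
have n_gt0 := expG_gt0 G.
have [a def_n] : exists a, expG G = (2 * a)%N.
  by exists (expG G)./2; rewrite mul2n even_halfK.
have cardG := card_le_expG_rank G; rewrite rkG def_n in cardG.
have dvdG := expG_dvd_card G.
have G_gt0 : (0 < #|G|)%N by apply/card_gt0P; exists 0.
have [m def_G] : exists m, #|G| = (m * (2 * a))%N by apply/dvdnP; rewrite -def_n.
have pig := s_pm_le_pigeonhole G.
(* For order 2 the iterated logarithm is 0 and [C] gives nothing, but the pigeonhole bound 3 is
   exactly 2 + 1. *)
have [G2|G_neq2] := eqVneq #|G| 2%N.
  have n2 : expG G = 2%N by rewrite G2 in dvdG; have := @dvdn_leq _ 2 isT dvdG; lia.
  have log2_2 : log2 (2%:R : R) = 1 by rewrite (log2_pow R 1).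
  have log2_1 : log2 (1 : R) = 0 by rewrite (log2_pow R 0).
  rewrite G2 n2 log2_2 log2_1 mulr0 addr0 natr1 ler_nat.
  by move: pig; rewrite G2 n2.
have G_ge4 : (2 ^ 2 <= #|G|)%N by lia.
set t := trunc_log 2 #|G|.
have le_t : t%:R <= log2 (#|G|%:R : R).
  by rewrite -(log2_pow R t) le_log2 ?ltr0n ?expn_gt0 // ler_nat trunc_logP.
have loglog : 1 <= log2 (log2 (#|G|%:R : R)).
  rewrite -[X in X <= _](log2_pow R 1) le_log2 ?ltr0n //.
  by rewrite -[X in X <= _](log2_pow R 2) le_log2 ?ltr0n // ler_nat.
have bound : (s_pm G <= expG G + t + C)%N.
  have [le_a|lt_a] := leqP a0 a.
    apply: (@leq_trans (2 * a + t + 1 + D)); last by rewrite def_n /C; lia.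
    apply: s_pm_le => g; rewrite def_n; apply: large => //.
    by rewrite card_ord.
  apply: leq_trans pig _.
  have : (#|G| * (expG G).-1 <= (2 * a0) ^ r * (2 * a0))%N.
    apply: leq_mul; last by lia.
    by apply: leq_trans cardG _; rewrite leq_exp2r //; lia.
  rewrite /C; lia.
apply: (@le_trans _ _ ((expG G + t + C)%:R)); first by rewrite ler_nat.
rewrite natrD natrD lerD ?lerD //.
by rewrite ler_peMr.
Qed.
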